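(* Let $c\geq 6$ be an integer and denote by $(\mathbb{N}_c^*,\leq)$ the poset with ground set $\{0,2,3,\ldots,c\}$ (all integers from $0$ to $c$ except $1$) and strict order given by $a<b\iff b-a\geq 2$. Then $(\mathbb{N}_c^*,\leq)$ is not a semigroup poset.
   Context: For a semigroup $T$ and a subsemigroup $S<T$ ($S=T$ allowed), define $t\leq_S t' :\iff \exists s\in S:\ ts=t'$ on $T$; when this is a partial order, $P(T,S)$ denotes $(T,\leq_S)$. A poset is a semigroup poset if it is isomorphic to $P(T,S)$ for some such semigroups $S<T$. *)

(* Defs.v *)
From HB Require Import structures.
From Stdlib Require Relation_Definitions.
From mathcomp Require Import all_boot all_order.
From mathcomp Require Import classical_sets.

Set Implicit Arguments.
Unset Strict Implicit.
Unset Printing Implicit Defensive.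

Import Order.TTheory.

(* Nonemptiness of [S] is not required: whenever [leS S] is reflexive on a
   nonempty [T], the set [S] is nonempty. *)
Definition subsemigroup (T : semigroupType) (S : set T) : Prop :=
  forall s s' : T, S s -> S s' -> S (s * s')%g.

Definition leS (T : semigroupType) (S : set T) (t t' : T) : Prop :=
  exists s : T, S s /\ (t * s)%g = t'.

(* The carrier of a [semigroupType] is a [choiceType]; this excludes no poset,
   since [P] is itself a [choiceType] and [f] is a bijection. *)
Definition semigroup_poset (d : Order.disp_t) (P : porderType d) : Prop :=
  exists (T : semigroupType) (S : set T),
    [/\ subsemigroup S,
        Relation_Definitions.order T (leS S) &
        exists f : P -> T,
          bijective f /\ forall x y : P, (x <= y)%O <-> leS S (f x) (f y)].

(* A fresh record, so that the natural order of ['I_c.+1] is not inherited. *)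
Record Nstar (c : nat) : predArgType :=
  MkNstar { Nstar_val :> 'I_c.+1; _ : nat_of_ord Nstar_val != 1 }.

HB.instance Definition _ (c : nat) := [isSub for @Nstar_val c].
HB.instance Definition _ (c : nat) := [Finite of Nstar c by <:].

(* Subtraction on [nat] is truncated, but [2 <= b - a] holds exactly when the
   integer difference of [b] and [a] is at least 2. *)
Definition Nstar_lt (c : nat) (a b : Nstar c) : bool := 2 <= b - a.

Lemma Nstar_lt_irr (c : nat) : irreflexive (@Nstar_lt c).
Proof. by move=> a; rewrite /Nstar_lt subnn. Qed.

Lemma Nstar_lt_trans (c : nat) : transitive (@Nstar_lt c).
Proof.
move=> b a e; rewrite /Nstar_lt !ltn_subRL => hab hbe.
by apply: ltn_trans hab (leq_ltn_trans (leq_addr 1 b) hbe).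
Qed.

Fact Nstar_display : Order.disp_t. Proof. exact: Order.Disp tt tt. Qed.

HB.instance Definition _ (c : nat) :=
  Order.Lt_isPOrder.Build Nstar_display (Nstar c)
    (@Nstar_lt_irr c) (@Nstar_lt_trans c).

(* Main.v *)
Require Import Defs.
From mathcomp Require Import all_boot all_order.
From mathcomp Require Import zify.
From Stdlib Require Import Relation_Definitions.

(** Suppose that [P(T, S)] is isomorphic to the poset on {0, 2, 3, ..., c}.
    A least element [z] of [P(T, S)] is automatically a two-sided identity of
    [T] ([least_mulg], [mulg_least]).  Every left translation [t |-> w * t] is
    monotone and open: it maps the up-set of [t] onto the up-set of [w * t]
    ([leS_mull], [leS_mull_lift]).  Translating by the element labelled 2 thus
    yields a monotone open self-map [F] of the poset with [F 0 = 2], and it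
    remains to see that there is none ([no_open_shift]).

    Such an [F] has image {2, 4, 5, ..., c}, and it sends the maximal elements
    [c - 1] and [c] to maximal elements.  Hence the value [c - 2] is taken at
    some element below [c], which forces [F c = c]; the value [c - 1] can then
    only be taken at [c - 1].  Going down, [F] fixes every [k >= 4]: if the
    larger numbers are fixed, the value [k] is taken at some number [b <= k],
    and for [b < k] the element [b] would lie below [k + 1] in the poset, so
    that [k = F b] would lie below [k + 1 = F (k + 1)], although consecutive
    numbers are incomparable.  Finally, 3 lies below 5 and 6, which are fixed
    because [c >= 6], and 2 is the only element of the image below both; so
    [F 3 = 2].  By openness the value 4 is then taken above 3, whereas the
    elements above 3 are 3 itself, mapped to 2, and 5, 6, ..., c, all fixed. *)

Section SemigroupOrder.

Context (T : semigroupType) (S : T -> Prop).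

Lemma leS_mull (w t t' : T) : leS S t t' -> leS S (w * t)%g (w * t')%g.
Proof. by case=> s [Ss <-]; exists s; rewrite mulgA. Qed.

(** Openness of left translations: the up-set of [w * t] is covered by the
    image of the up-set of [t]. *)
Lemma leS_mull_lift (w t y : T) :
  leS S (w * t)%g y -> exists2 t', leS S t t' & (w * t')%g = y.
Proof. by case=> s [Ss <-]; exists (t * s)%g; [exists s | rewrite mulgA]. Qed.

Hypothesis leS_order : order T (leS S).
Variable z : T.
Hypothesis z_least : forall t, leS S z t.

Lemma least_mulg (t : T) : (z * t)%g = t.
Proof.
case: leS_order => refl _ asym.
(* Some multiple of [z] equals [z], and [z * z] lies below all of them. *)
have zz : (z * z)%g = z.
  have [s [_ zs]] := refl z.
  by apply: asym => //; rewrite -{3}zs; apply/leS_mull/z_least.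
by have [s [_ <-]] := z_least t; rewrite mulgA zz.
Qed.

Lemma mulg_least (t : T) : (t * z)%g = t.
Proof.
case: leS_order => refl _ asym.
(* [z = z * s = s] for some [s] in [S]. *)
have Sz : S z by have [s [Ss zs]] := refl z; rewrite -zs least_mulg.
apply: asym; last by exists z.
by have [s [Ss ts]] := refl t; exists s; rewrite -mulgA least_mulg.
Qed.

End SemigroupOrder.

Section OpenSelfMap.

Variable c : nat.
Hypothesis c_ge6 : 6 <= c.

(** The ground set {0, 2, 3, ..., c}, as a subset of the natural numbers. *)
Let dom n := (n <= c) && (n != 1).
(** The reflexive order: distinct comparable elements differ by at least 2. *)
Let le a b := (a == b) || (a + 2 <= b).

(** The third hypothesis is the openness of [F].  The values of [F] at points
    outside {0, 2, 3, ..., c} are irrelevant. *)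
Lemma no_open_shift (F : nat -> nat) :
  (forall a, dom a -> dom (F a)) ->
  (forall a b, dom a -> dom b -> le a b -> le (F a) (F b)) ->
  (forall a y, dom a -> dom y -> le (F a) y ->
     exists b, [/\ dom b, le a b & F b = y]) ->
  F 0 <> 2.
Proof.
rewrite /dom /le => Fdom Fmono Fopen F0.
have Fge2 a : a <= c -> a != 1 -> F a = 2 \/ 4 <= F a <= c.
  by move=> ac a1; have := Fmono 0 a; have := Fdom a; lia.
have surj y : 4 <= y <= c -> exists b, [/\ b <= c, b != 1 & F b = y].
  by move=> hy; have [|||b []] := Fopen 0 y; try lia; exists b; split; lia.
have Fmax m : c <= m.+1 -> m <= c -> c <= (F m).+1.
  move=> cm mc; case: (leqP c (F m).+1) => // lt.
  have [|||b [hb mb Fb]] := Fopen m c; try lia.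
  have mE : m = b by lia.
  by move: lt; rewrite mE Fb; lia.
have Fc : F c = c.
  have [|b [bc b1 Fb]] := surj c.-2; first lia.
  have bnc : b <= c.-2.
    by case: (leqP b c.-2) => // ?; have := Fmax b; lia.
  by have := Fmono b c; have := Fmax c; have := Fdom c; lia.
have Fc1 : F c.-1 = c.-1.
  have [|b [bc b1 Fb]] := surj c.-1; first lia.
  have /or3P[/eqP bE|/eqP ebc|b_le] : [|| b == c.-1, b == c | b <= c.-2] by lia.
  - by rewrite -[in LHS]bE.
  - by move: Fb; rewrite ebc; lia.
  - by have := Fmono b c; lia.
(* Downward induction: all numbers from [c - i.+1] to [c], except those below
   4, are fixed. *)
have fix_down i j : c - i.+1 <= j <= c -> 4 <= j -> F j = j.
  elim: i j => [|i IHi] j hj j4.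
    by have [->|->] : j = c \/ j = c.-1 by lia.
  case: (leqP (c - i.+1) j) => [?|lt_j]; first by apply: IHi; lia.
  have [|b [bc b1 Fb]] := surj j; first lia.
  case: (ltngtP b j) => [lt_b|gt_b|bj]; last by rewrite -[in LHS]bj.
    by have := Fmono b j.+1; rewrite (IHi j.+1); lia.
  by move: Fb; rewrite IHi; lia.
have fix4 k : 4 <= k <= c -> F k = k.
  by move=> hk; apply: (fix_down c); lia.
have F3 : F 3 = 2.
  have := Fmono 3 5; have := Fmono 3 6; have := Fge2 3.
  by rewrite (fix4 5) ?(fix4 6); lia.
have [|||b [hb b3 Fb]] := Fopen 3 4; try lia.
have /orP[/eqP b3'|b5] := b3; first by move: Fb; rewrite -b3' F3.
by move: Fb; rewrite fix4; lia.
Qed.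

End OpenSelfMap.

Lemma Nstar_surj (c n : nat) : n <= c -> n != 1 ->
  exists x : Nstar c, x = n :> nat.
Proof. by move=> nc n1; exists (@MkNstar c (Ordinal (nc : n < c.+1)) n1). Qed.

Lemma Nstar_leE (c : nat) (x y : Nstar c) :
  (x <= y)%O = (x == y :> nat) || (x + 2 <= y).
Proof.
rewrite Order.POrderTheory.le_eqVlt -(inj_eq val_inj) -(inj_eq val_inj) /=.
by rewrite [(x < y)%O]/(2 <= y - x); lia.
Qed.

Theorem theorem3p4 (c : nat) (hc : 6 <= c) : ~ semigroup_poset (Nstar c).
Proof.
case=> T [S [_ Sord [f [[g fK gK] fle]]]].
have [o o0] : exists x : Nstar c, x = 0 :> nat by apply: Nstar_surj.
have [w w2] : exists x : Nstar c, x = 2 :> nat by apply: Nstar_surj; lia.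
have fo_least t : leS S (f o) t.
  rewrite -[t]gK; apply/fle; rewrite Nstar_leE o0.
  by case: (g t) => -[n ?] /=; lia.
(* Left translation by the element labelled 2, transported to the poset. *)
pose h x := g (f w * f x)%g.
have fh x : f (h x) = (f w * f x)%g by rewrite /h gK.
have h_mono x y : (x <= y)%O -> (h x <= h y)%O.
  by move=> /fle xy; apply/fle; rewrite !fh; apply: leS_mull.
have h_open x y : (h x <= y)%O -> exists2 x', (x <= x')%O & h x' = y.
  move=> /fle; rewrite fh => /leS_mull_lift[t xt wt].
  exists (g t); first by apply/fle; rewrite gK.
  by rewrite /h gK wt fK.
have ho : h o = w by rewrite /h (mulg_least _ _ Sord _ fo_least) fK.
(* [N n] is the element labelled [n], with an irrelevant value for [n = 1] and
   for [n > c]. *)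
pose N n : Nstar c := insubd o (inord n).
have NK n : (n <= c) && (n != 1) -> N n = n :> nat.
  move=> /andP[nc n1]; rewrite /N -[nat_of_ord _]/(nat_of_ord (val _)).
  by rewrite val_insubd inordK // n1 inordK.
have NatK (x : Nstar c) : N x = x by rewrite /N inord_val valKd.
have dom (x : Nstar c) : (x <= c) && (nat_of_ord x != 1).
  by case: x => x x1; rewrite leq_ord x1.
apply: (no_open_shift c hc (fun n => h (N n))).
- by move=> a _; exact: dom.
- move=> a b ad bd ab; rewrite -Nstar_leE; apply: h_mono.
  by rewrite Nstar_leE !NK.
- move=> a y ad yd ay.
  have [|x ax hx] := h_open (N a) (N y); first by rewrite Nstar_leE (NK y).
  by exists x; rewrite NatK hx NK // dom -[a]NK // -Nstar_leE.
- by have := NatK o; rewrite o0 => ->; rewrite ho.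
Qed.
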